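(* (a) The sets $\mathcal{U}^\pi_\Lambda \subset \mathcal{T}_\Lambda$, $\pi \in S_n$, form an open cover of $\mathcal{T}_\Lambda$. (b) If $E \in \mathcal{E}$ and $T \in \mathcal{U}^\pi_\Lambda$ then $ETE \in \mathcal{U}^\pi_\Lambda$. (c) If $T \in \mathcal{T}_\Lambda$ is unreduced then $T \in \mathcal{U}^\pi_\Lambda$ for all permutations $\pi\in S_n$. In particular, each set $\mathcal{U}^\pi_\Lambda$ is dense in $\mathcal{T}_\Lambda$. (d) Let $T \in \mathcal{T}_\Lambda$ have unreduced blocks $T_1,\ldots,T_k$ of dimensions $n_1,\ldots,n_k$ along the diagonal. For a permutation $\pi\in S_n$, split $\Lambda^\pi$ in blocks $$(\Lambda^\pi)_i = \operatorname{diag}\left(\lambda^\pi_{n_1+\cdots+n_{i-1}+1},\ldots,\lambda^\pi_{n_1+\cdots+n_{i-1}+n_i}\right),\quad i=1,\ldots,k.$$ Then $T \in \mathcal{U}^\pi_\Lambda$ if and only if $T_i$ is conjugate to $(\Lambda^\pi)_i$ for $i = 1,\ldots,k$.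
   Context: Fix real numbers $\lambda_1 < \cdots < \lambda_n$ and $\Lambda = \operatorname{diag}(\lambda_1,\ldots,\lambda_n)$. Let $\mathcal{T}_\Lambda$ be the set of real symmetric tridiagonal $n\times n$ matrices conjugate to $\Lambda$, which is a compact smooth submanifold, of dimension $n-1$, of the vector space of real symmetric tridiagonal matrices. $\mathcal{E}$ is the group of sign diagonals, i.e. matrices $\operatorname{diag}(\pm1,\ldots,\pm1)$ of order $n$. $Q^*$ denotes the transpose and $O(n)$ the real orthogonal group. A square matrix $M$ is $LU$-positive if it admits a (unique) factorization $M = LU$ with $L$ lower triangular with unit diagonal and $U$ upper triangular with positive diagonal entries (equivalently, all leading principal minors of $M$ are positive). For $\pi \in S_n$, let $\lambda^\pi_i = \lambda_{\pi(i)}$ and $\Lambda^\pi = \operatorname{diag}(\lambda^\pi_1,\ldots,\lambda^\pi_n)$. The chart domain $\mathcal{U}^\pi_\Lambda$ is the set of $T\in\mathcal{T}_\Lambda$ for which there exists an $LU$-positive matrix $Q_\pi \in O(n)$ with $T = Q_\pi^*\Lambda^\pi Q_\pi$. A symmetric tridiagonal matrix $T$ is unreduced if all entries $(T)_{i+1,i}$ are nonzero. Any symmetric tridiagonal $T$ splits, at the positions where $(T)_{i+1,i}=0$, as a block diagonal matrix with unreduced tridiagonal blocks $T_1,\ldots,T_k$ (listed in order along the diagonal; $1\times 1$ blocks are allowed). *)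

(* Defs.v *)
From HB Require Import structures.
From mathcomp Require Import all_boot all_order all_algebra all_fingroup.
From mathcomp Require Import all_classical all_reals all_analysis.

Set Implicit Arguments.
Unset Strict Implicit.
Unset Printing Implicit Defensive.

Import Order.TTheory GRing.Theory Num.Theory.
Import numFieldNormedType.Exports.

Local Open Scope classical_set_scope.
Local Open Scope ring_scope.

Definition conjugate_mx (R : realType) (n : nat) (A B : 'M[R]_n) : Prop :=
  A ~_{in unitmx} B.

Definition symmetric_mx (R : realType) (n : nat) (A : 'M[R]_n) : Prop :=
  A^T = A.

Definition tridiagonal_mx (R : realType) (n : nat) (A : 'M[R]_n) : Prop :=
  forall i j : 'I_n, ((i.+1 < j) || (j.+1 < i))%N -> A i j = 0.

(* Only meaningful for a symmetric tridiagonal matrix; true of every matrix of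
   order at most 1. *)
Definition unreduced (R : realType) (n : nat) (A : 'M[R]_n) : Prop :=
  forall i j : 'I_n, i = j.+1 :> nat -> A i j != 0.

Definition orthogonal_mx (R : realType) (n : nat) (Q : 'M[R]_n) : Prop :=
  Q^T *m Q = 1%:M.

(* [is_trig_mx] is the library's predicate for lower triangular matrices. *)
Definition LU_positive (R : realType) (n : nat) (M : 'M[R]_n) : Prop :=
  exists L U : 'M[R]_n,
    [/\ is_trig_mx L /\ (forall i, L i i = 1),
        is_trig_mx U^T /\ (forall i, 0 < U i i)
      & M = L *m U].

Definition sign_diagonal (R : realType) (n : nat) : set 'M[R]_n :=
  [set E | exists2 d : 'rV[R]_n,
     (forall i, d 0 i = 1 \/ d 0 i = -1) & E = diag_mx d].

Definition Lambda (R : realType) (n : nat) (lam : 'I_n -> R) : 'M[R]_n :=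
  diag_mx (\row_i lam i).

Definition Lambda_perm (R : realType) (n : nat) (lam : 'I_n -> R)
  (pi : 'S_n) : 'M[R]_n := Lambda (fun i => lam (pi i)).

Definition isospectral (R : realType) (n : nat) (lam : 'I_n -> R) :
    set 'M[R]_n :=
  [set T | [/\ symmetric_mx T, tridiagonal_mx T
             & conjugate_mx T (Lambda lam)]].

Definition chart_domain (R : realType) (n : nat) (lam : 'I_n -> R)
    (pi : 'S_n) : set 'M[R]_n :=
  [set T | isospectral lam T /\
     exists Q : 'M[R]_n, [/\ LU_positive Q, orthogonal_mx Q
       & T = Q^T *m Lambda_perm lam pi *m Q]].

(* [T] is block diagonal with unreduced blocks [B 0], ..., [B (k - 1)], in this
   order, of positive orders [p 0], ..., [p (k - 1)]. For symmetric tridiagonal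
   [T] such data exist and are unique. *)
Definition unreduced_blocks (R : realType) (n k : nat) (p : 'I_k -> nat)
    (e : (\sum_(i < k) p i)%N = n) (B : forall i : 'I_k, 'M[R]_(p i))
    (T : 'M[R]_n) : Prop :=
  [/\ forall i, (0 < p i)%N, forall i, unreduced (B i)
    & T = castmx (e, e) (\mxdiag_(i < k) B i)].

(* [tagnat.Rank i j] has value [p 0 + ... + p (i - 1) + j], see
   [tagnat.RankEsum]. *)
Definition Lambda_perm_block (R : realType) (n k : nat) (p : 'I_k -> nat)
    (e : (\sum_(i < k) p i)%N = n) (lam : 'I_n -> R) (pi : 'S_n)
    (i : 'I_k) : 'M[R]_(p i) :=
  Lambda (fun j : 'I_(p i) => lam (pi (cast_ord e (tagnat.Rank i j)))).

(* Main.v *)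
Require Import Defs.
From HB Require Import structures.
From mathcomp Require Import all_boot all_order all_algebra all_fingroup.
From mathcomp Require Import all_classical all_reals all_analysis.
From mathcomp Require Import ring.

Set Implicit Arguments.
Unset Strict Implicit.
Unset Printing Implicit Defensive.

Import Order.TTheory GRing.Theory Num.Theory.
Import numFieldNormedType.Exports.

Local Open Scope classical_set_scope.
Local Open Scope ring_scope.

(** A matrix [T] of the isospectral set has simple spectrum, so the rows of any
    invertible [P] with [P T = Lambda^pi P] are eigenvectors of [T], determined
    up to scaling. Symmetry makes them pairwise orthogonal; normalising them, and
    choosing signs, turns [P] into the orthogonal matrix of the definition of
    the chart. Neither operation affects which leading principal minors vanish,
    hence [chart_domainP]: [T] lies in the chart of [pi] iff such a [P] has an
    LU factorisation with invertible factors, i.e. iff all its leading minors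
    are nonzero ([has_LU_corners], [corners_has_LU]). The rest is read off this
    criterion.

    Cover. Some permutation of the rows of an invertible matrix has an LU
    factorisation ([has_LU_row_perm]); permuting the rows of [P] amounts to
    changing [pi].

    Openness. The product of the [T - lam_l], over [l] different from [i],
    projects onto the [i]th eigenline up to a scalar, so [P] can be chosen to
    depend polynomially on [T] ([probe]); the chart is then given, inside the
    isospectral set, by the nonvanishing of polynomials in [T]
    ([chart_domain_probe]).

    Unreduced matrices lie in every chart ([unreduced_eigen_corners]). A
    combination of [k] eigenvectors whose first [k] coordinates vanish is zero:
    applying [T - lam_s] removes one eigenvector and costs one vanishing
    coordinate, and an eigenvector whose first coordinate vanishes is zero.

    Density ([unreduced_dense]). If [Q = L U] diagonalises [T], then
    [Z = L^-1 Lambda L = U T U^-1] is both lower triangular and upper Hessenberg,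
    so it is lower bidiagonal, and the entries of [L] are explicit functions of
    its subdiagonal [beta] ([bidiag_eigen]). The entry of [T] at a subdiagonal
    place vanishes exactly when that of [Z] does. Replace the zero entries of
    [beta] by [eps], rebuild [L], and orthonormalise [L U] by Gram-Schmidt, that
    is by a right upper triangular factor. This gives unreduced matrices that
    tend to [T] with [eps].

    Blocks ([chart_domain_blocks]). For block diagonal [T], comparing diagonal
    blocks in [L^-1 Lambda L = U T U^-1] gives one implication; for the other,
    each block is unreduced, so its eigenvector matrix has an LU factorisation,
    and these assemble block diagonally. *)

(** * Triangular matrices and LU factorisation *)

Lemma trig_mulmx (F : fieldType) (n : nat) (A B : 'M[F]_n) :
  is_trig_mx A -> is_trig_mx B -> is_trig_mx (A *m B).
Proof.
move=> /is_trig_mxP trA /is_trig_mxP trB; apply/is_trig_mxP => i j ij.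
rewrite mxE big1 // => l _; have [il|li] := ltnP i l.
  by rewrite trA ?mul0r.
by rewrite trB ?mulr0 // (leq_ltn_trans li).
Qed.

Lemma trig_mulmx_diag (F : fieldType) (n : nat) (A B : 'M[F]_n) (i : 'I_n) :
  is_trig_mx A -> is_trig_mx B -> (A *m B) i i = A i i * B i i.
Proof.
move=> /is_trig_mxP trA /is_trig_mxP trB.
rewrite mxE (bigD1 i) //= big1 ?addr0 // => l; rewrite neq_ltn => /orP[li|il].
  by rewrite trB ?mulr0.
by rewrite trA ?mul0r.
Qed.

Lemma trig_unitmx (F : fieldType) (n : nat) (A : 'M[F]_n) :
  is_trig_mx A -> (A \in unitmx) = [forall i, A i i != 0].
Proof.
move=> trA; rewrite unitmxE det_trig // unitfE.
by apply/prodf_neq0/forallP => [h i|h i _]; exact: h.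
Qed.

(** Compare the entries of [A *m invmx A = 1] above the diagonal: row [i] is
    settled once all rows above it are. *)
Lemma trig_invmx (F : fieldType) (n : nat) (A : 'M[F]_n) :
  is_trig_mx A -> A \in unitmx -> is_trig_mx (invmx A).
Proof.
move=> trA uA; have := uA; rewrite trig_unitmx // => /forallP dA.
move/is_trig_mxP: trA => trA; apply/is_trig_mxP => i j.
have [k ik] := ubnP (i : nat); elim: k => // k IHk in i ik *; move=> ij.
have := congr1 (fun M : 'M[F]_n => M i j) (mulmxV uA).
rewrite !mxE (bigD1 i) //= big1 ?addr0 => [|l].
  by rewrite -val_eqE (ltn_eqF ij) => /eqP; rewrite mulf_eq0 (negPf (dA i)) => /eqP.
rewrite neq_ltn => /orP[li|il]; last by rewrite trA ?mul0r.
by rewrite IHk ?mulr0 // ?(ltn_trans li ij) // (leq_trans li).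
Qed.

Lemma trig_invmx_diag (F : fieldType) (n : nat) (A : 'M[F]_n) (i : 'I_n) :
  is_trig_mx A -> A \in unitmx -> invmx A i i = (A i i)^-1.
Proof.
move=> trA uA; have := uA; rewrite trig_unitmx // => /forallP dA.
apply: (mulfI (dA i)); rewrite mulfV //.
by rewrite -(trig_mulmx_diag _ trA (trig_invmx trA uA)) mulmxV // mxE eqxx.
Qed.

Lemma unitmx_ker0 (F : fieldType) (n : nat) (A : 'M[F]_n) :
  (forall w : 'rV[F]_n, w *m A = 0 -> w = 0) -> A \in unitmx.
Proof. by move=> kerA; rewrite -row_free_unit inj_row_free. Qed.

(** The variant of [LU_positive] without sign condition on the diagonal of [U].
    It is stable under scaling rows by nonzero factors of any sign. *)
Definition has_LU (F : fieldType) (n : nat) (M : 'M[F]_n) : Prop :=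
  exists L U : 'M[F]_n,
    [/\ is_trig_mx L /\ (forall i, L i i = 1),
        is_trig_mx U^T /\ (forall i, U i i != 0)
      & M = L *m U].

(** Its determinant is the leading principal minor of order [k]; padding with
    the identity keeps all these matrices of the same order [n]. *)
Definition corner (F : fieldType) (n k : nat) (M : 'M[F]_n) : 'M[F]_n :=
  \matrix_(i, j) if (i < k)%N && (j < k)%N then M i j else (i == j)%:R.

Definition corners_unit (F : fieldType) (n : nat) (M : 'M[F]_n) : Prop :=
  forall k : 'I_n.+1, corner k M \in unitmx.

Lemma corner_full (F : fieldType) (n : nat) (M : 'M[F]_n) : corner n M = M.
Proof. by apply/matrixP => i j; rewrite mxE !ltn_ord. Qed.

Lemma corner_trig (F : fieldType) (n k : nat) (M : 'M[F]_n) :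
  is_trig_mx M -> (forall i, M i i != 0) ->
  is_trig_mx (corner k M) /\ corner k M \in unitmx.
Proof.
move=> trM dM; have trC : is_trig_mx (corner k M).
  apply/is_trig_mxP => i j ij; rewrite mxE -val_eqE (ltn_eqF ij).
  by case: ifP => // _; rewrite (is_trig_mxP trM).
split; rewrite ?trig_unitmx //; apply/forallP => i; rewrite mxE eqxx.
by case: ifP => // _; rewrite oner_eq0.
Qed.

(** A product of a lower by an upper triangular matrix only sees the leading
    [k] by [k] corners of the factors when computing its own. *)
Lemma corner_mulmx_trig (F : fieldType) (n k : nat) (A B : 'M[F]_n) :
  is_trig_mx A -> is_trig_mx B^T ->
  corner k (A *m B) = corner k A *m corner k B.
Proof.
move=> /is_trig_mxP trA /is_trig_mxP trB; apply/matrixP => i j; rewrite !mxE.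
have [ik|ki] /= := ltnP i k; last first.
  rewrite (bigD1 i) //= !mxE ltnNge ki /= eqxx mul1r big1 ?addr0 // => l li.
  by rewrite !mxE ltnNge ki /= eq_sym (negPf li) mul0r.
have [jk|kj] /= := ltnP j k; last first.
  rewrite (bigD1 j) //= big1 => [|l lj]; last first.
    by rewrite !mxE [(j < k)%N]ltnNge kj andbF (negPf lj) mulr0.
  by rewrite !mxE [(j < k)%N]ltnNge kj !andbF eqxx mulr1 addr0.
apply: eq_bigr => l _; rewrite !mxE ik jk /= andbT.
case: ltnP => [//|kl]; rewrite trA ?mul0r ?(leq_trans ik) //.
by rewrite -val_eqE (ltn_eqF (leq_trans ik kl)) mul0r.
Qed.

Lemma has_LU_corners (F : fieldType) (n : nat) (M : 'M[F]_n) :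
  has_LU M -> corners_unit M.
Proof.
move=> [L [U [[trL dL] [trU dU] ->]]] k.
rewrite corner_mulmx_trig // unitmx_mul.
have [|_ ->] := @corner_trig _ _ k L trL; first by move=> i; rewrite dL oner_eq0.
rewrite -unitmx_tr (_ : (corner k U)^T = corner k U^T); last first.
  by apply/matrixP => i j; rewrite !mxE andbC eq_sym.
by have [|_ ->] := @corner_trig _ _ k _ trU; first by move=> i; rewrite mxE.
Qed.

(** The matrix of Gaussian elimination: row [i] adds to row [i] of [M] the unique
    combination of the rows above it that kills the entries left of the diagonal.
    That combination solves a system with matrix [corner i M], which makes the
    eliminator an explicit continuous function of [M]. *)
Definition eliminator (F : fieldType) (n : nat) (M : 'M[F]_n) : 'M[F]_n :=
  \matrix_i (delta_mx 0 i -
    (\row_j if (j < i)%N then M i j else 0) *m invmx (corner i M)).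

Lemma eliminatorP (F : fieldType) (n : nat) (M : 'M[F]_n) :
  corners_unit M ->
  [/\ is_trig_mx (eliminator M), forall i, eliminator M i i = 1
    & is_trig_mx (eliminator M *m M)^T].
Proof.
move=> uM; have uC (i : 'I_n) : corner i M \in unitmx.
  by have := uM (widen_ord (leqnSn n) i).
pose r (i : 'I_n) : 'rV[F]_n := \row_j if (j < i)%N then M i j else 0.
pose y i := r i *m invmx (corner i M).
have yC i : y i *m corner i M = r i by rewrite /y mulmxKV.
(* the padding of [corner i M] by the identity confines [y i] to columns
   before [i] *)
have y0 (i j : 'I_n) : (i <= j)%N -> y i 0 j = 0.
  move=> ij; have := congr1 (fun v : 'rV[F]_n => v 0 j) (yC i).
  rewrite /r !mxE [(j < i)%N]ltnNge ij /= (bigD1 j) //= big1 => [|l lj].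
    by rewrite !mxE [(j < i)%N]ltnNge ij /= eqxx mulr1 addr0.
  by rewrite !mxE [(j < i)%N]ltnNge ij andbF (negPf lj) mulr0.
have XE i j : eliminator M i j = (j == i)%:R - y i 0 j.
  by rewrite !mxE eqxx.
split=> [|i|].
- apply/is_trig_mxP => i j ij.
  by rewrite XE y0 ?subr0 1?ltnW // -val_eqE (gtn_eqF ij).
- by rewrite XE y0 // eqxx subr0.
apply/is_trig_mxP => j i ji; rewrite mxE mxE.
have := congr1 (fun v : 'rV[F]_n => v 0 j) (yC i); rewrite /r !mxE ji.
rewrite (eq_bigr (fun l => y i 0 l * M l j)) => [yM|l _]; last first.
  rewrite [corner _ _ _ _]mxE ji andbT; case: ltnP => // il.
  by rewrite y0 ?mul0r.
rewrite (eq_bigr (fun l => (l == i)%:R * M l j - y i 0 l * M l j)); last first.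
  by move=> l _; rewrite XE mulrBl.
rewrite sumrB yM (bigD1 i) //= eqxx mul1r big1 ?addr0 ?subrr // => l li.
by rewrite (negPf li) mul0r.
Qed.

Lemma corners_has_LU (F : fieldType) (n : nat) (M : 'M[F]_n) :
  corners_unit M -> has_LU M.
Proof.
move=> uM; have [trX dX trU] := eliminatorP uM.
have uX : eliminator M \in unitmx.
  by rewrite trig_unitmx //; apply/forallP => i; rewrite dX oner_eq0.
exists (invmx (eliminator M)), (eliminator M *m M); split; last by rewrite mulKmx.
  split=> [|i]; first exact: trig_invmx.
  by rewrite trig_invmx_diag // dX invr1.
split=> // i; have : (eliminator M *m M)^T \in unitmx.
  rewrite unitmx_tr unitmx_mul uX /=.
  by have := uM ord_max; rewrite corner_full.
by rewrite trig_unitmx // => /forallP/(_ i); rewrite mxE.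
Qed.

Lemma has_LU_unit (F : fieldType) (n : nat) (M : 'M[F]_n) :
  has_LU M -> M \in unitmx.
Proof. by move/has_LU_corners/(_ ord_max); rewrite corner_full. Qed.

Lemma mul_diag_mxE (F : fieldType) (m n : nat) (d : 'rV[F]_m) (A : 'M[F]_(m, n)) i j :
  (diag_mx d *m A) i j = d 0 i * A i j.
Proof. by rewrite mul_diag_mx mxE. Qed.

Lemma mul_mx_diagE (F : fieldType) (m n : nat) (d : 'rV[F]_n) (A : 'M[F]_(m, n)) i j :
  (A *m diag_mx d) i j = A i j * d 0 j.
Proof. by rewrite mul_mx_diag mxE. Qed.

Lemma unitmx_diag (F : fieldType) (n : nat) (d : 'rV[F]_n) :
  (forall i, d 0 i != 0) -> diag_mx d \in unitmx.
Proof.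
move=> nz; rewrite trig_unitmx ?diag_mx_is_trig //.
by apply/forallP => i; rewrite mxE eqxx mulr1n.
Qed.

(** With [D = diag_mx d], the new lower factor is [D L D^-1]. *)
Lemma scale_rows_LU (F : fieldType) (n : nat) (d : 'rV[F]_n) (L U : 'M[F]_n) :
  (forall i, d 0 i != 0) ->
  is_trig_mx L -> (forall i, L i i = 1) -> is_trig_mx U^T ->
  exists L' : 'M[F]_n, [/\ is_trig_mx L', forall i, L' i i = 1,
    is_trig_mx (diag_mx d *m U)^T,
    forall i, (diag_mx d *m U) i i = d 0 i * U i i
    & diag_mx d *m (L *m U) = L' *m (diag_mx d *m U)].
Proof.
move=> nz trL dL trU; have uD := unitmx_diag nz.
have trD := diag_mx_is_trig d.
exists (diag_mx d *m L *m invmx (diag_mx d)); split=> [|i||i|].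
- by rewrite !trig_mulmx ?trig_invmx.
- rewrite !trig_mulmx_diag ?trig_mulmx ?trig_invmx //.
  by rewrite trig_invmx_diag // dL mxE eqxx mulr1n mulr1 mulfV.
- by rewrite trmx_mul tr_diag_mx trig_mulmx.
- exact: mul_diag_mxE.
by rewrite !mulmxA mulmxKV.
Qed.

Lemma has_LU_scale_rows (F : fieldType) (n : nat) (d : 'rV[F]_n) (M : 'M[F]_n) :
  (forall i, d 0 i != 0) -> has_LU M -> has_LU (diag_mx d *m M).
Proof.
move=> nz [L [U [[trL dL] [trU dU] ->]]].
have [L' [trL' dL' trU' dU' ->]] := scale_rows_LU nz trL dL trU.
exists L', (diag_mx d *m U); split=> //; split=> // i.
by rewrite dU' mulf_neq0.
Qed.

Lemma has_LU_scale_cols (F : fieldType) (n : nat) (d : 'rV[F]_n) (M : 'M[F]_n) :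
  (forall i, d 0 i != 0) -> has_LU M -> has_LU (M *m diag_mx d).
Proof.
move=> nz [L [U [[trL dL] [trU dU] ->]]].
exists L, (U *m diag_mx d); split; rewrite ?mulmxA //; split=> [|i].
  by rewrite trmx_mul tr_diag_mx trig_mulmx ?diag_mx_is_trig.
by rewrite mul_mx_diagE mulf_neq0.
Qed.

(** LU factorisation with pivoting. *)
Lemma has_LU_row_perm (F : fieldType) (n : nat) (A : 'M[F]_n) :
  A \in unitmx -> exists s : 'S_n, has_LU (row_perm s A).
Proof.
case: n A => [|n] A uA.
  exists 1%g, 1%:M, 1%:M; split; try by split=> [|[]//]; apply/is_trig_mxP => -[].
  by apply/matrixP => -[].
have := cormen_lup_correct A; have := cormen_lup_perm A.
have := @cormen_lup_lower _ _ A; have := @cormen_lup_upper _ _ A.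
case: (cormen_lup A) => [[P L] U] /= upU lowL /is_perm_mxP[s ->] PA.
have E : row_perm s A = L *m U by rewrite row_permE.
have trL : is_trig_mx L.
  by apply/is_trig_mxP => i j ij; rewrite lowL 1?ltnW // -val_eqE (ltn_eqF ij).
have trU : is_trig_mx U^T by apply/is_trig_mxP => i j ij; rewrite mxE upU.
have : L *m U \in unitmx by rewrite -E row_permE unitmx_mul unitmx_perm.
rewrite unitmx_mul -[U \in _]unitmx_tr => /andP[_].
rewrite trig_unitmx // => /forallP dU.
exists s, L, U; split=> //; split=> // i; first by rewrite lowL // eqxx.
by have := dU i; rewrite mxE.
Qed.

(** * Eigenvector matrices of symmetric tridiagonal matrices *)

(** The Gram matrix of the eigenvectors commutes with the diagonal matrix of the
    eigenvalues, which are distinct. *)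
Lemma gram_eigen_diag (F : fieldType) (n : nat) (d : 'rV[F]_n) (P T : 'M[F]_n) :
  injective (d 0) -> T^T = T -> P *m T = diag_mx d *m P ->
  is_diag_mx (P *m P^T).
Proof.
move=> injd symT PT; apply/is_diag_mxP => i j ij.
have E : diag_mx d *m (P *m P^T) = (P *m P^T) *m diag_mx d.
  by rewrite mulmxA -PT -mulmxA -{1}symT -trmx_mul PT trmx_mul tr_diag_mx mulmxA.
have := congr1 (fun M : 'M[F]_n => M i j) E.
rewrite mul_diag_mxE mul_mx_diagE mulrC => /eqP.
rewrite -subr_eq0 -mulrBr mulf_eq0 subr_eq0 => /orP[/eqP //|/eqP/injd/eqP].
by rewrite -val_eqE (negPf ij).
Qed.

Lemma gram_diag_gt0 (F : realFieldType) (n : nat) (P : 'M[F]_n) (i : 'I_n) :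
  P \in unitmx -> 0 < (P *m P^T) i i.
Proof.
move=> uP; have E : (P *m P^T) i i = \sum_j P i j ^+ 2.
  by rewrite mxE; apply: eq_bigr => j _; rewrite mxE expr2.
rewrite lt_def E sumr_ge0 ?andbT => [|j _]; last exact: sqr_ge0.
apply/negP => /eqP/psumr_eq0P s0.
have : row i P = 0.
  apply/rowP => j; rewrite !mxE; apply/eqP; rewrite -sqrf_eq0; apply/eqP.
  by apply: s0 => // l _; exact: sqr_ge0.
move/(congr1 (mulmx^~ (invmx P))); rewrite -row_mul mulmxV // mul0mx row1.
by move/rowP/(_ i)/eqP; rewrite !mxE !eqxx oner_eq0.
Qed.

(** Divide each eigenvector by its norm, with the sign that makes the
    corresponding diagonal entry of the upper factor positive. *)
Lemma orthonormalize_eigen (R : realType) (n : nat) (mu : 'I_n -> R)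
    (P T : 'M[R]_n) :
  injective mu -> T^T = T -> has_LU P -> P *m T = Lambda mu *m P ->
  exists Q : 'M[R]_n, [/\ LU_positive Q, orthogonal_mx Q
    & T = Q^T *m Lambda mu *m Q].
Proof.
move=> injmu symT luP PT; have uP := has_LU_unit luP.
have diagG : is_diag_mx (P *m P^T).
  by apply: gram_eigen_diag symT PT => i j; rewrite !mxE => /injmu.
case: luP => L [U [[trL dL] [trU dU] PE]].
pose g i := (P *m P^T) i i; have g0 i : 0 < g i by exact: gram_diag_gt0.
pose s : 'rV[R]_n := \row_i (Num.sg (U i i) / Num.sqrt (g i)).
have s0 i : s 0 i != 0.
  by rewrite mxE mulf_neq0 ?sgr_eq0 // invr_eq0 sqrtr_eq0 -ltNge.
have [L' [trL' dL' trU' dU' QE]] := scale_rows_LU s0 trL dL trU.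
have QQt : (diag_mx s *m P) *m (diag_mx s *m P)^T = 1%:M.
  rewrite trmx_mul tr_diag_mx -mulmxA [P *m _]mulmxA.
  apply/matrixP => i j; rewrite mul_diag_mxE mul_mx_diagE [RHS]mxE.
  have [<-|ij] := eqVneq i j; last first.
    by rewrite (is_diag_mxP diagG) ?val_eqE // mul0r mulr0.
  rewrite -/(g i) mulrCA -expr2 [s 0 i]mxE exprMn sqr_sg dU mul1r exprVn.
  by rewrite sqr_sqrtr ?ltW // mulfV // gt_eqF.
have orthQ : orthogonal_mx (diag_mx s *m P) by exact: mulmx1C.
exists (diag_mx s *m P); split=> //.
  exists L', (diag_mx s *m U); split; rewrite ?PE //; split=> // i.
  rewrite dU' mxE mulrAC -normrEsg divr_gt0 ?normr_gt0 ?sqrtr_gt0 //.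
rewrite -mulmxA [Lambda mu *m _]mulmxA diag_mxC -mulmxA -PT.
by rewrite [diag_mx s *m (_ *m _)]mulmxA mulmxA orthQ mul1mx.
Qed.

Lemma conjugate_LambdaP (R : realType) (n : nat) (mu : 'I_n -> R) (T : 'M[R]_n) :
  conjugate_mx T (Lambda mu) <->
  exists2 P : 'M[R]_n, P \in unitmx & P *m T = Lambda mu *m P.
Proof.
by split=> -[P uP PT]; exists P => //; apply/(simmxP uP).
Qed.

Lemma eigen_row_perm (R : realType) (n : nat) (lam : 'I_n -> R) (pi : 'S_n)
    (P T : 'M[R]_n) :
  P *m T = Lambda lam *m P ->
  row_perm pi P *m T = Lambda_perm lam pi *m row_perm pi P.
Proof.
move=> PT; rewrite row_permE -mulmxA PT mulmxA -row_permE.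
apply/matrixP => i j; rewrite mul_diag_mxE -row_permE !mxE.
rewrite (bigD1 (pi i)) //= !mxE eqxx mulr1n big1 ?addr0 // => l li.
by rewrite !mxE eq_sym (negPf li) mul0r.
Qed.

Lemma conjugate_Lambda_perm (R : realType) (n : nat) (lam : 'I_n -> R)
    (pi : 'S_n) (T : 'M[R]_n) :
  conjugate_mx T (Lambda_perm lam pi) <-> conjugate_mx T (Lambda lam).
Proof.
split=> /conjugate_LambdaP[P uP PT]; apply/conjugate_LambdaP.
  exists (row_perm pi^-1 P); first by rewrite row_permE unitmx_mul unitmx_perm.
  rewrite (eigen_row_perm pi^-1 PT); congr (_ *m _); congr diag_mx.
  by apply/rowP => i; rewrite !mxE permKV.
exists (row_perm pi P); first by rewrite row_permE unitmx_mul unitmx_perm.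
exact: eigen_row_perm.
Qed.

(** The working description of the charts: orthogonality and positivity have
    disappeared, and any eigenvector matrix may be used. *)
Lemma chart_domainP (R : realType) (n : nat) (lam : 'I_n -> R) (pi : 'S_n)
    (T : 'M[R]_n) :
  injective lam ->
  chart_domain lam pi T <->
  isospectral lam T /\
  exists2 P : 'M[R]_n, has_LU P & P *m T = Lambda_perm lam pi *m P.
Proof.
move=> injlam; split=> -[isoT].
  move=> [Q [[L [U [triL [trU dU] QE]]] orthQ TE]]; split=> //; exists Q.
    by exists L, U; split=> //; split=> // i; rewrite gt_eqF.
  by rewrite TE !mulmxA (mulmx1C orthQ) mul1mx.
move=> [P luP PT]; split=> //; have [symT _ _] := isoT.
by apply: orthonormalize_eigen luP PT => // i j /injlam/perm_inj.
Qed.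

Lemma chart_domain_cover (R : realType) (n : nat) (lam : 'I_n -> R)
    (T : 'M[R]_n) :
  injective lam -> isospectral lam T -> exists pi : 'S_n, chart_domain lam pi T.
Proof.
move=> injlam isoT; have [_ _ /conjugate_LambdaP[P uP PT]] := isoT.
have [pi luP] := has_LU_row_perm uP; exists pi.
by apply/(chart_domainP _ _ injlam); split=> //; exists (row_perm pi P);
  last exact: eigen_row_perm.
Qed.

Lemma sign_diagonal_sqr (R : realType) (n : nat) (d : 'rV[R]_n) :
  (forall i, d 0 i = 1 \/ d 0 i = -1) -> diag_mx d *m diag_mx d = 1%:M.
Proof.
move=> sd; apply/matrixP => i j; rewrite mul_diag_mxE !mxE.
have [->|_] := eqVneq i j; last by rewrite mulr0.
by rewrite mulr1n; case: (sd j) => ->; rewrite ?mulrNN mulr1.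
Qed.

Lemma isospectral_sign (R : realType) (n : nat) (lam : 'I_n -> R)
    (E T : 'M[R]_n) :
  sign_diagonal E -> isospectral lam T -> isospectral lam (E *m T *m E).
Proof.
move=> [d sd ->] [symT triT /conjugate_LambdaP[P uP PT]].
have dd := sign_diagonal_sqr sd; split.
- by rewrite /symmetric_mx !trmx_mul tr_diag_mx symT mulmxA.
- by move=> i j ij; rewrite mul_mx_diagE mul_diag_mxE triT // mulr0 mul0r.
apply/conjugate_LambdaP; exists (P *m diag_mx d).
  by rewrite unitmx_mul uP; have /mulmx1_unit[] := dd.
by rewrite !mulmxA -PT -[P *m _ *m _]mulmxA dd mulmx1.
Qed.

Lemma chart_domain_sign (R : realType) (n : nat) (lam : 'I_n -> R) (pi : 'S_n)
    (E T : 'M[R]_n) :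
  injective lam -> sign_diagonal E ->
  chart_domain lam pi T -> chart_domain lam pi (E *m T *m E).
Proof.
move=> injlam sE /(chart_domainP _ _ injlam)[isoT [P luP PT]].
apply/(chart_domainP _ _ injlam); split; first exact: isospectral_sign.
case: sE => d sd ->; exists (P *m diag_mx d).
  apply: has_LU_scale_cols => // i.
  by case: (sd i) => ->; rewrite ?oppr_eq0 oner_eq0.
rewrite !mulmxA -PT -[P *m _ *m _]mulmxA.
by rewrite (sign_diagonal_sqr sd) mulmx1.
Qed.

Definition hessenberg (F : fieldType) (n : nat) (A : 'M[F]_n) : Prop :=
  forall i j : 'I_n, (j.+1 < i)%N -> A i j = 0.

(** An eigenvector of an unreduced matrix is determined by its first coordinate:
    column [j] of [v T = a v] expresses coordinate [j + 1] by the previous ones. *)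
Lemma unreduced_eigenvector (R : realType) (n : nat) (T : 'M[R]_n)
    (a : R) (v : 'rV[R]_n) :
  hessenberg T -> unreduced T -> v *m T = a *: v ->
  (forall j : 'I_n, j = 0%N :> nat -> v 0 j = 0) -> v = 0.
Proof.
move=> hesT unrT vT v0; apply/rowP => j; rewrite mxE.
have [k jk] := ubnP (j : nat); elim: k => // k IHk in j jk *.
have [/v0 //|j0] := eqVneq (j : nat) 0%N.
have lt_j'n : (j.-1 < n)%N by rewrite (leq_ltn_trans (leq_pred j)).
pose j' := Ordinal lt_j'n.
have jE : j = j'.+1 :> nat by rewrite /= prednK // lt0n.
have := congr1 (fun w : 'rV[R]_n => w 0 j') vT; rewrite !mxE.
have lt0 (l : 'I_n) : (l < j)%N -> v 0 l = 0.
  by move=> lj; apply: IHk; rewrite (leq_trans lj).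
rewrite (bigD1 j) //= (lt0 j') ?jE // mulr0 big1 ?addr0 => [|l].
  by move/eqP; rewrite mulf_eq0 (negPf (unrT _ _ jE)) orbF => /eqP.
rewrite neq_ltn => /orP[/lt0 ->|jl]; first by rewrite mul0r.
by rewrite hesT ?mulr0 // -jE.
Qed.

(** [w] is a combination of eigenvectors, [w *m P] the resulting vector; the
    induction is on the number [k] of eigenvectors involved. *)
Lemma unreduced_eigen_corners (R : realType) (n : nat) (mu : 'I_n -> R)
    (P T : 'M[R]_n) :
  injective mu -> hessenberg T -> unreduced T ->
  P \in unitmx -> P *m T = Lambda mu *m P -> corners_unit P.
Proof.
move=> injmu hesT unrT uP PT.
have key k : forall w : 'rV[R]_n, (#|[pred i | w 0%R i != 0%R]| <= k)%N ->
    (forall j : 'I_n, (j < k)%N -> (w *m P) 0 j = 0) -> w = 0.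
  elim: k => [|k IHk] w.
    rewrite leqn0 => /eqP/card0_eq w0 _; apply/rowP => i.
    by have := w0 i; rewrite !inE mxE => /negbFE/eqP.
  move=> wk wP; apply/eqP/negP => /negP/rV0Pn[s ws].
  pose w' : 'rV[R]_n := \row_i (w 0 i * (mu i - mu s)).
  have w'P : w' *m P = w *m P *m T - mu s *: (w *m P).
    rewrite -mulmxA PT mulmxA scalemxAl -mulmxBl; congr (_ *m _).
    by apply/rowP => i; rewrite [in RHS]mxE mul_mx_diagE !mxE mulrBr [mu s * _]mulrC.
  (* applying [T - mu s] kills the component along eigenvector [s] and, [T] being
     Hessenberg, costs one vanishing coordinate *)
  have w'0 : w' = 0.
    apply: IHk => [|j jk].
      move: wk; rewrite (cardD1 s) !inE ws add1n ltnS; apply: leq_trans.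
      apply/subset_leq_card/fintype.subsetP => i; rewrite !inE mxE mulf_eq0 negb_or.
      by case/andP=> -> ; rewrite subr_eq0 andbT; apply: contraNneq => ->.
    rewrite w'P mxE [X in _ + X]mxE [X in _ - X]mxE wP 1?ltnW // mulr0 subr0.
    rewrite mxE big1 // => l _; have [lk|kl] := ltnP l k.+1.
      by rewrite wP ?mul0r.
    by rewrite hesT ?mulr0 // (leq_trans _ kl).
  have vT : w *m P *m T = mu s *: (w *m P).
    by apply/eqP; rewrite -subr_eq0 -w'P w'0 mul0mx.
  have : w *m P = 0.
    by apply: unreduced_eigenvector vT _ => // j j0; apply: wP; rewrite j0.
  move/(congr1 (mulmx^~ (invmx P))); rewrite mulmxK // mul0mx => w0.
  by move: ws; rewrite w0 mxE eqxx.
move=> k; apply: unitmx_ker0 => w wC.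
have w0 (j : 'I_n) : (k <= j)%N -> w 0 j = 0.
  move=> kj; have := congr1 (fun v : 'rV[R]_n => v 0 j) wC.
  rewrite !mxE (bigD1 j) //= big1 => [|l lj].
    by rewrite !mxE [(j < k)%N]ltnNge kj /= eqxx mulr1 addr0.
  by rewrite !mxE [(j < k)%N]ltnNge kj andbF (negPf lj) mulr0.
apply: (key k) => [|j jk].
  rewrite cardE -(size_map val) -[X in (_ <= X)%N](size_iota 0).
  apply: uniq_leq_size; first by rewrite map_inj_uniq ?enum_uniq //; exact: val_inj.
  move=> x /mapP[i]; rewrite mem_enum inE => wi ->; rewrite mem_iota add0n /=.
  by rewrite ltnNge; apply: contraNN wi => /w0 ->.
have := congr1 (fun v : 'rV[R]_n => v 0 j) wC.
rewrite [LHS]mxE [RHS]mxE => wC0; rewrite mxE -[RHS]wC0.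
apply: eq_bigr => l _; rewrite mxE jk andbT; case: ltnP => // kl.
by rewrite w0 ?mul0r.
Qed.

(** * Block diagonal matrices *)

(** Restricting to a diagonal block is multiplicative as soon as the cross terms
    vanish; this covers block triangular matrices of either kind. *)
Lemma submxblock_mul_diag (F : fieldType) (k : nat) (p : 'I_k -> nat)
    (A C : 'M[F]_(\sum_i p i)) (i : 'I_k) :
  (forall l, l != i -> submxblock A i l *m submxblock C l i = 0) ->
  submxblock (A *m C) i i = submxblock A i i *m submxblock C i i.
Proof.
move=> AC0; rewrite -{1}[A]submxblockK -{1}[C]submxblockK mul_mxblock mxblockK.
by rewrite (bigD1 i) //= big1 ?addr0.
Qed.

Lemma trig_submxblock (F : fieldType) (k : nat) (p : 'I_k -> nat)
    (A : 'M[F]_(\sum_i p i)) (i j : 'I_k) :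
  is_trig_mx A -> (i < j)%N -> submxblock A i j = 0.
Proof. by rewrite -{1}[A]submxblockK => /is_trig_mxblockP[h _] /h. Qed.

Lemma submxblock_mul_trig (F : fieldType) (k : nat) (p : 'I_k -> nat)
    (A C : 'M[F]_(\sum_i p i)) (i : 'I_k) :
  is_trig_mx A -> is_trig_mx C ->
  submxblock (A *m C) i i = submxblock A i i *m submxblock C i i.
Proof.
move=> trA trC; apply: submxblock_mul_diag => l; rewrite neq_ltn => /orP[li|il].
  by rewrite (trig_submxblock trC li) mulmx0.
by rewrite (trig_submxblock trA il) mul0mx.
Qed.

Lemma submxblock1 (F : fieldType) (k : nat) (p : 'I_k -> nat) (i : 'I_k) :
  submxblock (1%:M : 'M[F]_(\sum_i p i)) i i = 1%:M.
Proof.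
apply/matrixP => a b; rewrite !mxE -val_eqE /= tagnat.eq_Rank eqxx /=.
by rewrite val_eqE.
Qed.

Lemma submxblock_mul_trigT (F : fieldType) (k : nat) (p : 'I_k -> nat)
    (A C : 'M[F]_(\sum_i p i)) (i : 'I_k) :
  is_trig_mx A^T -> is_trig_mx C^T ->
  submxblock (A *m C) i i = submxblock A i i *m submxblock C i i.
Proof.
move=> trA trC; apply: trmx_inj; rewrite trmx_mul !tr_submxblock trmx_mul.
exact: submxblock_mul_trig.
Qed.

Lemma submxblock_mul_mxdiag (F : fieldType) (k : nat) (p : 'I_k -> nat)
    (A : 'M[F]_(\sum_i p i)) (B : forall i : 'I_k, 'M[F]_(p i)) (i j : 'I_k) :
  submxblock (A *m mxdiag B) i j = submxblock A i j *m B j.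
Proof. by rewrite -{1}[A]submxblockK mul_mxblock_mxdiag mxblockK. Qed.

Lemma submxblock_Lambda (R : realType) (k : nat) (p : 'I_k -> nat)
    (mu : 'I_(\sum_i p i) -> R) (i : 'I_k) :
  submxblock (Lambda mu) i i = Lambda (fun j => mu (tagnat.Rank i j)).
Proof.
apply/matrixP => a b; rewrite !mxE -val_eqE /= tagnat.eq_Rank eqxx /=.
by rewrite val_eqE.
Qed.

(** Take the [i]th diagonal blocks in [U T U^-1 = L^-1 Lambda L]. *)
Lemma similar_diag_blocks (R : realType) (k : nat) (p : 'I_k -> nat)
    (B : forall i : 'I_k, 'M[R]_(p i)) (mu : 'I_(\sum_i p i) -> R)
    (P : 'M[R]_(\sum_i p i)) (i : 'I_k) :
  has_LU P -> P *m mxdiag B = Lambda mu *m P ->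
  conjugate_mx (B i) (Lambda (fun j => mu (tagnat.Rank i j))).
Proof.
move=> [L [U [[trL dL] [trU dU] ->]]] PB.
have uL : L \in unitmx.
  by rewrite trig_unitmx //; apply/forallP => s; rewrite dL oner_eq0.
have uU : U \in unitmx.
  by rewrite -unitmx_tr trig_unitmx //; apply/forallP => s; rewrite mxE.
have trL' := trig_invmx trL uL.
have trU' : is_trig_mx (invmx U)^T by rewrite trmx_inv trig_invmx ?unitmx_tr.
have trD : is_trig_mx (Lambda mu) by exact: diag_mx_is_trig.
have LL : submxblock L i i *m submxblock (invmx L) i i = 1%:M.
  by rewrite -submxblock_mul_trig // mulmxV // submxblock1.
have UU : submxblock (invmx U) i i *m submxblock U i i = 1%:M.
  by rewrite -submxblock_mul_trigT // mulVmx // submxblock1.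
have [uLi _] := mulmx1_unit LL; have [_ uUi] := mulmx1_unit UU.
apply/conjugate_LambdaP; exists (submxblock L i i *m submxblock U i i).
  by rewrite unitmx_mul uLi.
have : U *m mxdiag B *m invmx U = invmx L *m (Lambda mu *m L).
  by apply: (canRL (mulKmx uL)); rewrite !mulmxA PB mulmxA mulmxK.
move/(congr1 (fun M => submxblock M i i)).
rewrite [RHS]submxblock_mul_trig ?trig_mulmx //.
rewrite [submxblock (_ *m L) i i]submxblock_mul_trig // submxblock_Lambda.
rewrite submxblock_mul_diag ?submxblock_mul_mxdiag => [E|l].
  rewrite -[_ *m B i]mulmx1 -UU !mulmxA -[_ *m B i]mulmxA in E *.
  rewrite -[submxblock L i i *m _ *m _]mulmxA E.
  by rewrite !mulmxA LL mul1mx.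
rewrite submxblock_mul_mxdiag neq_ltn => /orP[li|il].
  rewrite [submxblock U i l](_ : _ = 0) ?mul0mx //.
  by rewrite -[submxblock _ _ _]trmxK tr_submxblock (trig_submxblock trU li) trmx0.
rewrite [submxblock _ l i](_ : _ = 0) ?mulmx0 //.
by rewrite -[submxblock _ _ _]trmxK tr_submxblock (trig_submxblock trU' il) trmx0.
Qed.

Lemma mxdiag_trig (F : fieldType) (k : nat) (p : 'I_k -> nat)
    (A : forall i : 'I_k, 'M[F]_(p i)) :
  (forall i, is_trig_mx (A i)) -> is_trig_mx (mxdiag A).
Proof.
move=> trA; apply/is_trig_mxblockP; split=> [i j ij|i].
  by rewrite -val_eqE (ltn_eqF ij).
by rewrite eqxx conform_mx_id.
Qed.

Lemma mxdiagE (F : fieldType) (k : nat) (p : 'I_k -> nat)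
    (A : forall i : 'I_k, 'M[F]_(p i)) (i : 'I_k) (a b : 'I_(p i)) :
  mxdiag A (tagnat.Rank i a) (tagnat.Rank i b) = A i a b.
Proof.
have := congr1 (fun M : 'M[F]_(p i) => M a b) (submxblock_diag A i).
by rewrite mxE.
Qed.

Lemma mul_mxdiag (F : fieldType) (k : nat) (p : 'I_k -> nat)
    (A C : forall i : 'I_k, 'M[F]_(p i)) :
  mxdiag A *m mxdiag C = mxdiag (fun i => A i *m C i).
Proof.
rewrite mul_mxdiag_mxblock; apply: eq_mxblock => i j.
case: eqVneq => [<-|_]; last by rewrite mulmx0.
by rewrite !conform_mx_id.
Qed.

Lemma mxdiag_has_LU (F : fieldType) (k : nat) (p : 'I_k -> nat)
    (P : forall i : 'I_k, 'M[F]_(p i)) :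
  (forall i, has_LU (P i)) -> has_LU (mxdiag P).
Proof.
move=> /fin_all_exists[L] /fin_all_exists[U] LU.
exists (mxdiag L), (mxdiag U); split.
- split=> [|s]; first by apply: mxdiag_trig => i; have [[]] := LU i.
  rewrite -[s]tagnat.sig2K mxdiagE.
  by have [[_ ->]] := LU (tagnat.sig1 s).
- split=> [|s].
    by rewrite tr_mxdiag; apply: mxdiag_trig => i; have [_ []] := LU i.
  by rewrite -[s]tagnat.sig2K mxdiagE; have [_ []] := LU (tagnat.sig1 s).
by rewrite mul_mxdiag; apply: eq_mxdiag => i; have [] := LU i.
Qed.

Lemma Lambda_mxdiag (R : realType) (k : nat) (p : 'I_k -> nat)
    (mu : 'I_(\sum_i p i) -> R) :
  Lambda mu = mxdiag (fun i => Lambda (fun j => mu (tagnat.Rank i j))).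
Proof.
rewrite -[LHS]submxblockK; apply: eq_mxblock => i j.
case: eqVneq => [<-|ij]; first by rewrite conform_mx_id submxblock_Lambda.
by apply/matrixP => a b; rewrite !mxE -val_eqE /= tagnat.eq_Rank (negPf ij).
Qed.

Lemma chart_domain_blocks (R : realType) (n : nat) (lam : 'I_n -> R)
    (T : 'M[R]_n) (k : nat) (p : 'I_k -> nat) (e : (\sum_(i < k) p i)%N = n)
    (B : forall i : 'I_k, 'M[R]_(p i)) (pi : 'S_n) :
  injective lam -> isospectral lam T -> unreduced_blocks e B T ->
  chart_domain lam pi T <->
  (forall i : 'I_k, conjugate_mx (B i) (Lambda_perm_block e lam pi i)).
Proof.
case: n / e => // in lam T pi *; move=> injlam isoT [_ unrB].
rewrite castmx_id => TE.
have blockE i : Lambda_perm_block erefl lam pi i =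
    Lambda (fun j => lam (pi (tagnat.Rank i j))).
  by congr diag_mx; apply/rowP => j; rewrite !mxE cast_ord_id.
rewrite chart_domainP //; split=> [[_ [P luP PT]] i|conjB].
  rewrite blockE; move: PT; rewrite TE /Lambda_perm.
  exact: (similar_diag_blocks (mu := fun s => lam (pi s))).
split=> //; have triT : tridiagonal_mx T by case: isoT.
have /fin_all_exists[P PB] : forall i, exists P : 'M[R]_(p i),
    has_LU P /\ P *m B i = Lambda (fun j => lam (pi (tagnat.Rank i j))) *m P.
  move=> i; have := conjB i; rewrite blockE => /conjugate_LambdaP[P uP PB].
  exists P; split=> //; apply: corners_has_LU.
  apply: unreduced_eigen_corners uP PB => // [a b|a b ba].
    move=> /injlam/perm_inj/(congr1 val)/eqP.
    by rewrite /= tagnat.eq_Rank eqxx /= => /eqP/val_inj.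
  rewrite -mxdiagE -TE triT //.
  by rewrite !tagnat.RankEsum -!addnS !leq_add2l ba orbT.
exists (mxdiag P); first by apply: mxdiag_has_LU => i; case: (PB i).
rewrite TE /Lambda_perm Lambda_mxdiag !mul_mxdiag.
by apply: eq_mxdiag => i; case: (PB i).
Qed.

(** * Entrywise convergence, and openness of the charts *)

(** Entrywise, so that the limit laws of real functions apply without assuming
    that the orders are positive. *)
Definition mx_cvg (R : realType) (X : Type) (F : set_system X) (m n : nat)
    (f : X -> 'M[R]_(m, n)) (A : 'M[R]_(m, n)) : Prop :=
  forall i j, f x i j @[x --> F] --> A i j.

Lemma nbhs_mx_cvg (R : realType) (X : Type) (F : set_system X) {FF : Filter F}
    (m n : nat) (f : X -> 'M[R]_(m, n)) (A : 'M[R]_(m, n)) (V : set 'M[R]_(m, n)) :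
  mx_cvg F f A -> nbhs A V -> \forall x \near F, V (f x).
Proof.
move=> fA [P AP PV]; have : \forall x \near F, forall i j, P i j (f x i j).
  apply: filter_forall => i; apply: filter_forall => j.
  exact: (fA i j _ (AP i j)).
by apply: filterS => x; exact: PV.
Qed.

Lemma mx_cvg_nbhs (R : realType) (m n : nat) (A : 'M[R]_(m, n)) :
  mx_cvg (nbhs A) id A.
Proof. by move=> i j; apply: coord_continuous. Qed.

Lemma sum_cvg (R : realType) (X : Type) (F : set_system X) {FF : Filter F}
    (I : Type) (r : seq I) (P : pred I) (f : I -> X -> R) (l : I -> R) :
  (forall i, P i -> f i x @[x --> F] --> l i) ->
  \sum_(i <- r | P i) f i x @[x --> F] --> \sum_(i <- r | P i) l i.
Proof. by apply: cvg_big; exact: add_continuous. Qed.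

Lemma prod_cvg (R : realType) (X : Type) (F : set_system X) {FF : Filter F}
    (I : Type) (r : seq I) (P : pred I) (f : I -> X -> R) (l : I -> R) :
  (forall i, P i -> f i x @[x --> F] --> l i) ->
  \prod_(i <- r | P i) f i x @[x --> F] --> \prod_(i <- r | P i) l i.
Proof. by apply: cvg_big; exact: mul_continuous. Qed.

Section EntrywiseConvergence.
Context (R : realType) (X : Type) (F : set_system X) {FF : Filter F}.

Lemma mx_cvg_cst (m n : nat) (A : 'M[R]_(m, n)) : mx_cvg F (fun=> A) A.
Proof. by move=> i j; exact: cvg_cst. Qed.

Lemma mx_cvg_tr (m n : nat) (f : X -> 'M[R]_(m, n)) A :
  mx_cvg F f A -> mx_cvg F (fun x => (f x)^T) A^T.
Proof. by move=> fA i j; rewrite mxE; under eq_cvg do rewrite mxE; exact: fA. Qed.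

Lemma mx_cvg_mul (m n p : nat) (f : X -> 'M[R]_(m, n)) (g : X -> 'M[R]_(n, p)) A B :
  mx_cvg F f A -> mx_cvg F g B -> mx_cvg F (fun x => f x *m g x) (A *m B).
Proof.
move=> fA gB i j; rewrite mxE; under eq_cvg do rewrite mxE.
by apply: sum_cvg => l _; exact: cvgM.
Qed.

Lemma mx_cvg_sub (m n : nat) (f g : X -> 'M[R]_(m, n)) A B :
  mx_cvg F f A -> mx_cvg F g B -> mx_cvg F (fun x => f x - g x) (A - B).
Proof.
move=> fA gB i j; rewrite !mxE; under eq_cvg do rewrite !mxE.
by apply: cvgB; [exact: fA|exact: gB].
Qed.

Lemma det_cvg (n : nat) (f : X -> 'M[R]_n) A :
  mx_cvg F f A -> \det (f x) @[x --> F] --> \det A.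
Proof.
move=> fA; apply: sum_cvg => s _; apply: cvgM; first exact: cvg_cst.
by apply: prod_cvg => i _; exact: fA.
Qed.

Lemma near_unitmx (n : nat) (f : X -> 'M[R]_n) A :
  mx_cvg F f A -> A \in unitmx -> \forall x \near F, f x \in unitmx.
Proof.
rewrite unitmxE unitfE => /det_cvg fA A0.
near=> x; rewrite unitmxE unitfE; near: x; exact: cvgr_neq0 fA A0.
Unshelve. all: by end_near. Qed.

Lemma mx_cvg_inv (n : nat) (f : X -> 'M[R]_n) A :
  mx_cvg F f A -> A \in unitmx -> mx_cvg F (fun x => invmx (f x)) (invmx A).
Proof.
move=> fA uA i j; have nuf := near_unitmx fA uA.
(* near [A], the inverse is given by Cramer's rule *)
apply: (@cvg_trans _ ((\det (f x))^-1 * cofactor (f x) j i @[x --> F])).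
  by apply: near_eq_cvg; near=> x; rewrite /invmx (near nuf x) // !mxE.
rewrite /invmx uA !mxE; apply: cvgM; first apply: cvgV.
- by move: uA; rewrite unitmxE unitfE.
- exact: det_cvg.
apply: cvgM; first exact: cvg_cst.
by apply: det_cvg => a b; rewrite !mxE; under eq_cvg do rewrite !mxE; exact: fA.
Unshelve. all: by end_near. Qed.

Lemma mx_cvg_corner (n k : nat) (f : X -> 'M[R]_n) A :
  mx_cvg F f A -> mx_cvg F (fun x => corner k (f x)) (corner k A).
Proof.
move=> fA i j; rewrite mxE; under eq_cvg do rewrite mxE.
by case: ifP => _; [exact: fA|exact: cvg_cst].
Qed.

Lemma near_corners_unit (n : nat) (f : X -> 'M[R]_n) A :
  mx_cvg F f A -> corners_unit A -> \forall x \near F, corners_unit (f x).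
Proof.
move=> fA uA; apply: filter_forall => k.
by apply: near_unitmx (uA k); exact: mx_cvg_corner.
Qed.

Lemma mx_cvg_eliminator (n : nat) (f : X -> 'M[R]_n) A :
  mx_cvg F f A -> corners_unit A ->
  mx_cvg F (fun x => eliminator (f x)) (eliminator A).
Proof.
move=> fA uA i j; rewrite mxE; under eq_cvg do rewrite mxE.
apply: mx_cvg_sub; first exact: mx_cvg_cst.
apply: mx_cvg_mul.
  move=> a b; rewrite mxE; under eq_cvg do rewrite mxE.
  by case: ifP => _; [exact: fA|exact: cvg_cst].
apply: mx_cvg_inv; first exact: mx_cvg_corner.
exact: (uA (widen_ord (leqnSn n) i)).
Qed.

End EntrywiseConvergence.

Definition shift_prod (R : realType) (n : nat) (T : 'M[R]_n) (s : seq R)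
    (w : 'rV[R]_n) : 'rV[R]_n :=
  foldl (fun v a => v *m (T - a%:M)) w s.

(** Row [i] is an eigenvector of [T] for [mu i], possibly zero: row [i] of [W] is
    projected, up to a scalar, onto the [i]th eigenline of [T]. The choice of [W]
    does not depend on [T], so that the result is polynomial in [T]. *)
Definition probe (R : realType) (n : nat) (mu : 'I_n -> R) (W T : 'M[R]_n) :
    'M[R]_n :=
  \matrix_i shift_prod T [seq mu l | l <- enum 'I_n & l != i] (row i W).

Lemma shift_prod_eigen (R : realType) (n : nat) (mu : 'I_n -> R)
    (P T : 'M[R]_n) (s : seq R) (w : 'rV[R]_n) :
  P *m T = Lambda mu *m P ->
  shift_prod T s (w *m P) =
  (\row_i (w 0 i * \prod_(a <- s) (mu i - a))) *m P.
Proof.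
move=> PT; elim: s w => [|a s IHs] w /=.
  by congr (_ *m _); apply/rowP => i; rewrite mxE big_nil mulr1.
have -> : w *m P *m (T - a%:M) = (\row_i (w 0 i * (mu i - a))) *m P.
  rewrite mulmxBr -mulmxA PT mul_mx_scalar mulmxA scalemxAl -mulmxBl.
  congr (_ *m _); apply/rowP => i.
  by rewrite [LHS]mxE mul_mx_diagE !mxE mulrBr [a * _]mulrC.
rewrite -/(shift_prod _ _ _) IHs; congr (_ *m _); apply/rowP => i.
by rewrite !mxE big_cons mulrA.
Qed.

Lemma probe_eigen (R : realType) (n : nat) (mu : 'I_n -> R) (W P T : 'M[R]_n) :
  P *m T = Lambda mu *m P ->
  probe mu (W *m P) T =
  diag_mx (\row_i (W i i * \prod_(l | l != i) (mu i - mu l))) *m P.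
Proof.
move=> PT; apply/row_matrixP => i; rewrite rowK row_mul (shift_prod_eigen _ _ PT).
rewrite row_mul; congr (_ *m _); apply/rowP => j; rewrite !mxE.
have [<-|ij] := eqVneq i j.
  by rewrite big_map big_filter big_enum_cond mulr1n.
rewrite mulr0n; apply/eqP; rewrite mulf_eq0; apply/orP; right.
rewrite big_map big_filter big_enum_cond prodf_seq_eq0; apply/hasP.
by exists j; rewrite ?mem_index_enum // eq_sym ij subrr eqxx.
Qed.

Lemma mx_cvg_probe (R : realType) (n : nat) (mu : 'I_n -> R) (W T : 'M[R]_n) :
  mx_cvg (nbhs T) (probe mu W) (probe mu W T).
Proof.
have cvg_shift s (f : 'M[R]_n -> 'rV[R]_n) (v : 'rV[R]_n) : mx_cvg (nbhs T) f v ->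
    mx_cvg (nbhs T) (fun S => shift_prod S s (f S)) (shift_prod T s v).
  elim: s f v => //= a s IHs f v fv; apply: IHs; apply: mx_cvg_mul fv _.
  by apply: mx_cvg_sub; [exact: mx_cvg_nbhs|exact: mx_cvg_cst].
move=> i j; rewrite mxE; under eq_cvg do rewrite mxE.
by apply: cvg_shift; exact: mx_cvg_cst.
Qed.

(** For a fixed [W] the corners of [probe mu W T] depend continuously on [T], so
    they stay invertible near any [T] where they are. *)
Lemma open_corners_probe (R : realType) (n : nat) (mu : 'I_n -> R) :
  open [set T : 'M[R]_n | exists W, corners_unit (probe mu W T)].
Proof.
have nearT (T W : 'M[R]_n) : corners_unit (probe mu W T) ->
    \forall S \near T, corners_unit (probe mu W S).
  move=> uW; exact: (near_corners_unit (@mx_cvg_probe R n mu W T) uW).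
rewrite openE => T [W uW]; rewrite /interior /=.
by apply: filterS (nearT T W uW) => S uS; exists W.
Qed.

(** An eigenvector matrix [P] of [T] is itself a good probe, since each of its
    rows is only rescaled by a nonzero factor. *)
Lemma chart_domain_probe (R : realType) (n : nat) (lam : 'I_n -> R) (pi : 'S_n) :
  injective lam ->
  chart_domain lam pi = isospectral lam `&`
    [set T | exists W, corners_unit (probe (fun i => lam (pi i)) W T)].
Proof.
move=> injlam; apply/seteqP; split=> T.
  move/(chart_domainP _ _ injlam) => [isoT [P luP PT]]; split=> //; exists P.
  rewrite -[P in probe _ P]mul1mx (probe_eigen _ PT).
  apply: has_LU_corners; apply: has_LU_scale_rows luP => i.
  rewrite !mxE eqxx mul1r; apply/prodf_neq0 => l li.
  by rewrite subr_eq0; apply: contraNneq li => /injlam/perm_inj ->.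
move=> [isoT [W]]; have [_ _ conjT] := isoT.
have /conjugate_LambdaP[P uP PT] : conjugate_mx T (Lambda_perm lam pi).
  exact/conjugate_Lambda_perm.
rewrite -[W](mulmxKV uP) (probe_eigen _ PT).
set d := \row_i _ => /corners_has_LU luP.
apply/(chart_domainP _ _ injlam); split=> //; exists (diag_mx d *m P) => //.
by rewrite -mulmxA PT [RHS]mulmxA diag_mxC mulmxA.
Qed.

(** * Bidiagonal coordinates, and density of the unreduced matrices *)

Lemma hessenberg_mul_upper (F : fieldType) (n : nat) (A U : 'M[F]_n) :
  hessenberg A -> is_trig_mx U^T -> hessenberg (A *m U).
Proof.
move=> hesA /is_trig_mxP trU i j ji; rewrite mxE big1 // => l _.
have [lj|jl] := leqP l j; first by rewrite hesA ?mul0r // (leq_ltn_trans _ ji).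
by have := trU _ _ jl; rewrite mxE => ->; rewrite mulr0.
Qed.

Lemma upper_mul_hessenberg (F : fieldType) (n : nat) (U A : 'M[F]_n) :
  is_trig_mx U^T -> hessenberg A -> hessenberg (U *m A).
Proof.
move=> /is_trig_mxP trU hesA i j ji; rewrite mxE big1 // => l _.
have [il|li] := leqP i l; first by rewrite hesA ?mulr0 // (leq_trans ji).
by have := trU _ _ li; rewrite mxE => ->; rewrite mul0r.
Qed.

Lemma upper_mul_subdiag (F : fieldType) (n : nat) (U A : 'M[F]_n) (i j : 'I_n) :
  is_trig_mx U^T -> hessenberg A -> i = j.+1 :> nat ->
  (U *m A) i j = U i i * A i j.
Proof.
move=> /is_trig_mxP trU hesA ij; rewrite mxE (bigD1 i) //= big1 ?addr0 // => l.
rewrite neq_ltn => /orP[li|il]; last by rewrite hesA ?mulr0 // -ij.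
by have := trU _ _ li; rewrite mxE => ->; rewrite mul0r.
Qed.

Lemma subdiag_mul_upper (F : fieldType) (n : nat) (U A : 'M[F]_n) (i j : 'I_n) :
  is_trig_mx U^T -> hessenberg A -> i = j.+1 :> nat ->
  (A *m U) i j = A i j * U j j.
Proof.
move=> /is_trig_mxP trU hesA ij; rewrite mxE (bigD1 j) //= big1 ?addr0 // => l.
rewrite neq_ltn => /orP[lj|jl]; first by rewrite hesA ?mul0r // ij ltnS.
by have := trU _ _ jl; rewrite mxE => ->; rewrite mulr0.
Qed.

Definition bidiag (F : fieldType) (n : nat) (mu beta : 'I_n -> F) : 'M[F]_n :=
  \matrix_(i, j) if i == j then mu i
                 else if i == j.+1 :> nat then beta j else 0.

(** The closed form of the unit lower triangular matrix of left eigenvectors of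
    [bidiag mu beta]; see [bidiag_eigenP] and [bidiag_eigen_unique]. *)
Definition bidiag_eigen (F : fieldType) (n : nat) (mu beta : 'I_n -> F) :
    'M[F]_n :=
  \matrix_(i, j) if (i < j)%N then 0
    else \prod_(l < n | (j <= l < i)%N) (beta l / (mu i - mu l)).

Lemma bidiag_eigen_trig (F : fieldType) (n : nat) (mu beta : 'I_n -> F) :
  is_trig_mx (bidiag_eigen mu beta).
Proof. by apply/is_trig_mxP => i j ij; rewrite mxE ij. Qed.

Lemma bidiag_eigen_diag (F : fieldType) (n : nat) (mu beta : 'I_n -> F) i :
  bidiag_eigen mu beta i i = 1.
Proof.
by rewrite mxE ltnn big1 // => l /andP[il]; rewrite ltnNge il.
Qed.

(** The eigenvector equation for row [i], read in column [j]. *)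
Lemma bidiag_eigen_rec (F : fieldType) (n : nat) (mu beta : 'I_n -> F)
    (i j j' : 'I_n) :
  j' = j.+1 :> nat -> (j < i)%N ->
  bidiag_eigen mu beta i j = beta j / (mu i - mu j) * bidiag_eigen mu beta i j'.
Proof.
move=> jj' ji; rewrite !mxE jj' ltnNge (ltnW ji) ltnNge ji /=.
rewrite (bigD1 j) ?leqnn //=; congr (_ * _); apply: eq_bigl => l.
by rewrite -val_eqE /= [in RHS]ltn_neqAle eq_sym; case: eqVneq; rewrite ?andbF ?andbT.
Qed.

Lemma bidiag_mulE (F : fieldType) (n : nat) (mu beta : 'I_n -> F) (A : 'M[F]_n)
    (i j : 'I_n) :
  (A *m bidiag mu beta) i j =
  A i j * mu j + \sum_(l < n | l == j.+1 :> nat) A i l * beta j.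
Proof.
rewrite mxE (bigD1 j) //= mxE eqxx; congr (_ + _).
rewrite [LHS](bigID (fun l : 'I_n => l == j.+1 :> nat)) /= [X in _ + X]big1 ?addr0.
  apply: eq_big => [l|l /andP[lj lj1]]; last by rewrite mxE (negPf lj) lj1.
  by case: (eqVneq l j) => //= ->; rewrite ltn_eqF.
by move=> l /andP[lj lj1]; rewrite mxE (negPf lj) (negPf lj1) mulr0.
Qed.

Lemma bidiag_eigenP (F : fieldType) (n : nat) (mu beta : 'I_n -> F) :
  injective mu ->
  bidiag_eigen mu beta *m bidiag mu beta =
  diag_mx (\row_i mu i) *m bidiag_eigen mu beta.
Proof.
move=> injmu; apply/matrixP => i j; rewrite bidiag_mulE mul_diag_mxE [_ 0 i]mxE.
have Ltrig := is_trig_mxP (bidiag_eigen_trig mu beta).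
have [ij|ji|/val_inj ij] := ltngtP i j.
- rewrite Ltrig // mul0r mulr0 add0r big1 // => l /eqP lj.
  by rewrite Ltrig ?mul0r // lj (ltn_trans ij).
- have ij0 : mu i - mu j != 0.
    by rewrite subr_eq0; apply: contraTneq ji => /injmu ->; rewrite ltnn.
  pose j' := Ordinal (leq_ltn_trans ji (ltn_ord i)).
  rewrite (big_pred1 j') => [|l]; last by rewrite /= -val_eqE.
  rewrite (@bidiag_eigen_rec _ _ _ _ i j j') //.
  by move: (bidiag_eigen _ _ _ _) (mu i) (mu j) (beta j) ij0 => x a b c ab0; field.
rewrite ij bidiag_eigen_diag mul1r mulr1 big1 ?addr0 // => l /eqP lj.
by rewrite Ltrig ?mul0r // lj.
Qed.

(** Away from the diagonal, row [i] of the eigenvector equation determines the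
    entries from right to left, since [mu i != mu j]. *)
Lemma bidiag_eigen_unique (F : fieldType) (n : nat) (mu beta : 'I_n -> F)
    (L : 'M[F]_n) :
  injective mu -> is_trig_mx L -> (forall i, L i i = 1) ->
  L *m bidiag mu beta = diag_mx (\row_i mu i) *m L ->
  L = bidiag_eigen mu beta.
Proof.
move=> injmu trL dL LZ; apply/matrixP => i j.
have Ltrig := is_trig_mxP (bidiag_eigen_trig mu beta).
have [ij|ji|/val_inj ->] := ltngtP i j; last by rewrite dL bidiag_eigen_diag.
  by rewrite (is_trig_mxP trL) // Ltrig.
have [d] := ubnP (i - j)%N; elim: d => // d IHd in j ji *; move=> ijd.
have ij0 : mu i - mu j != 0.
  by rewrite subr_eq0; apply: contraTneq ji => /injmu ->; rewrite ltnn.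
pose j' := Ordinal (leq_ltn_trans ji (ltn_ord i)).
rewrite (@bidiag_eigen_rec _ _ _ _ i j j') //.
have <- : L i j' = bidiag_eigen mu beta i j'.
  have [ij'|ij'] := ltnP j' i; last first.
    have -> : j' = i by apply/val_inj/eqP; rewrite eqn_leq ij' andbT.
    by rewrite dL bidiag_eigen_diag.
  by apply: IHd => //=; rewrite subnS -ltnS prednK // subn_gt0.
have := congr1 (fun M : 'M[F]_n => M i j) LZ.
rewrite bidiag_mulE mul_diag_mxE [_ 0 i]mxE.
rewrite (big_pred1 j') => [|l]; last by rewrite /= -val_eqE.
move: (L i j) (L i j') (mu i) (mu j) (beta j) ij0 => x y a b c ab0 E.
by apply: (mulfI ab0); rewrite mulrBl -E; field.
Qed.

Definition subdiag (F : fieldType) (n : nat) (A : 'M[F]_n) (j : 'I_n) : F :=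
  \sum_(l < n | l == j.+1 :> nat) A l j.

Lemma lower_hessenberg_bidiag (F : fieldType) (n : nat) (mu : 'I_n -> F)
    (A : 'M[F]_n) :
  is_trig_mx A -> hessenberg A -> (forall i, A i i = mu i) ->
  A = bidiag mu (subdiag A).
Proof.
move=> /is_trig_mxP trA hesA dA; apply/matrixP => i j; rewrite mxE.
have [->//|neq_ij] := eqVneq i j; have [ij|ij] := eqVneq (i : nat) j.+1.
  by rewrite /subdiag (big_pred1 i) // => l; rewrite /= -ij val_eqE.
have [lt_ij|ji|/val_inj E] := ltngtP i j; first by rewrite trA.
  by rewrite hesA // ltn_neqAle eq_sym ij.
by rewrite E eqxx in neq_ij.
Qed.

Lemma bidiag_hessenberg (F : fieldType) (n : nat) (mu beta : 'I_n -> F) :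
  hessenberg (bidiag mu beta).
Proof.
move=> i j ji; rewrite mxE (gtn_eqF ji) -val_eqE.
by rewrite (gtn_eqF (ltn_trans (ltnSn j) ji)).
Qed.

(** Both [T] and [Z] represent [Lambda^pi], in bases related by the upper
    triangular [Y], that is [T = Y^-1 Z Y]. So [T] inherits the Hessenberg form
    of [Z], and the nonvanishing of its subdiagonal; symmetry does the rest. *)
Lemma isospectral_of_LU (R : realType) (n : nat) (lam : 'I_n -> R) (pi : 'S_n)
    (L Z Y : 'M[R]_n) :
  L \in unitmx -> L *m Z = Lambda_perm lam pi *m L ->
  hessenberg Z -> (forall i j : 'I_n, i = j.+1 :> nat -> Z i j != 0) ->
  is_trig_mx Y^T -> orthogonal_mx (L *m Y) ->
  isospectral lam ((L *m Y)^T *m Lambda_perm lam pi *m (L *m Y)) /\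
  unreduced ((L *m Y)^T *m Lambda_perm lam pi *m (L *m Y)).
Proof.
move=> uL LZ hesZ Z0 trY orthQ; set T := _ *m _ *m _.
have [_ uQ] := mulmx1_unit orthQ.
have uY : Y \in unitmx by move: uQ; rewrite unitmx_mul uL.
have QT : L *m Y *m T = Lambda_perm lam pi *m (L *m Y).
  by rewrite !mulmxA (mulmx1C orthQ) mul1mx.
have YT : Y *m T = Z *m Y.
  by apply: (can_inj (mulKmx uL)); rewrite [LHS]mulmxA QT !mulmxA LZ.
have symT : T^T = T.
  rewrite /T [LHS]trmx_mul [(_ *m Lambda_perm _ _)^T]trmx_mul.
  by rewrite trmxK tr_diag_mx mulmxA.
have trY' : is_trig_mx (invmx Y)^T by rewrite trmx_inv trig_invmx ?unitmx_tr.
have hesT : hessenberg T.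
  rewrite -[T](mulKmx uY) YT.
  by apply: upper_mul_hessenberg => //; exact: hessenberg_mul_upper.
have dY i : Y i i != 0.
  by move: uY; rewrite -unitmx_tr trig_unitmx // => /forallP/(_ i); rewrite mxE.
split; last first.
  move=> i j ij; apply: contraNneq (Z0 _ _ ij) => Tij.
  have := congr1 (fun M : 'M[R]_n => M i j) YT.
  rewrite (upper_mul_subdiag trY hesT ij) (subdiag_mul_upper trY hesZ ij).
  move=> /esym/eqP; rewrite Tij mulr0.
  by rewrite mulf_eq0 (negPf (dY j)) orbF.
split=> //.
  by move=> i j /orP[ij|ji]; [rewrite -symT mxE|]; exact: hesT.
by apply/(conjugate_Lambda_perm _ pi)/conjugate_LambdaP; exists (L *m Y).
Qed.

(** The upper triangular matrix that orthonormalises the columns of [A]. With [X]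
    the eliminator of the Gram matrix [G] of [A], the matrix [X G X^T] is both
    symmetric and upper triangular, so the columns of [A X^T] are orthogonal. *)
Definition gram_schmidt (R : realType) (n : nat) (A : 'M[R]_n) : 'M[R]_n :=
  let X := eliminator (A^T *m A) in
  X^T *m diag_mx (\row_i (Num.sqrt ((X *m (A^T *m A) *m X^T) i i))^-1).

Lemma gram_schmidt_trig (R : realType) (n : nat) (A : 'M[R]_n) :
  corners_unit (A^T *m A) -> is_trig_mx (gram_schmidt A)^T.
Proof.
move=> uM; have [trX _ _] := eliminatorP uM.
by rewrite trmx_mul tr_diag_mx trmxK trig_mulmx ?diag_mx_is_trig.
Qed.

Lemma gram_schmidt_orthogonal (R : realType) (n : nat) (A : 'M[R]_n) :
  corners_unit (A^T *m A) ->
  (forall i, 0 < (eliminator (A^T *m A) *m (A^T *m A) *m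
                  (eliminator (A^T *m A))^T) i i) ->
  orthogonal_mx (A *m gram_schmidt A).
Proof.
move=> uM; have [trX _ trU] := eliminatorP uM.
rewrite /orthogonal_mx /gram_schmidt; set X := eliminator _ in trX trU *.
set D := X *m _ *m _ => D0.
have symD : D^T = D by rewrite /D !trmx_mul !trmxK !mulmxA.
have diagD : is_diag_mx D.
  have trD : is_trig_mx D by rewrite -symD trmx_mul trmxK trig_mulmx.
  apply/is_diag_mxP => i j; rewrite neq_ltn => /orP[ij|ji].
    exact: (is_trig_mxP trD).
  by rewrite -symD mxE (is_trig_mxP trD).
set s := \row_i _.
have -> : (A *m (X^T *m diag_mx s))^T *m (A *m (X^T *m diag_mx s)) =
    diag_mx s *m D *m diag_mx s.
  by rewrite !trmx_mul tr_diag_mx trmxK /D !mulmxA.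
apply/matrixP => i j; rewrite mul_mx_diagE mul_diag_mxE [RHS]mxE.
have [<-|ij] := eqVneq i j; last first.
  by rewrite (is_diag_mxP diagD) ?val_eqE // mulr0 mul0r.
rewrite mulrAC -expr2 mxE exprVn sqr_sqrtr ?ltW //.
by rewrite mulVf // gt_eqF.
Qed.

Lemma eliminator1 (F : fieldType) (n : nat) : eliminator (1%:M : 'M[F]_n) = 1%:M.
Proof.
apply/matrixP => i j; rewrite mxE [\row__ _](_ : _ = 0) ?mul0mx ?subr0.
  by rewrite !mxE eqxx eq_sym.
by apply/rowP => l; rewrite !mxE -val_eqE; case: ltnP => // li; rewrite gtn_eqF.
Qed.

Lemma corners_unit1 (F : fieldType) (n : nat) : corners_unit (1%:M : 'M[F]_n).
Proof.
move=> k; rewrite (_ : corner k _ = 1%:M) ?unitmx1 //.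
by apply/matrixP => i j; rewrite !mxE; case: ifP.
Qed.

(** Near an orthogonal matrix the Gram matrix is near the identity, where the
    pivots are invertible and the squared norms are positive. *)
Lemma mx_cvg_gram_schmidt (R : realType) (X : Type) (F : set_system X)
    {FF : Filter F} (n : nat) (f : X -> 'M[R]_n) (Q : 'M[R]_n) :
  orthogonal_mx Q -> mx_cvg F f Q ->
  mx_cvg F (fun x => f x *m gram_schmidt (f x)) Q /\
  \forall x \near F, corners_unit ((f x)^T *m f x) /\
    orthogonal_mx (f x *m gram_schmidt (f x)).
Proof.
move=> orthQ fQ.
have cvgG : mx_cvg F (fun x => (f x)^T *m f x) 1%:M.
  by rewrite -orthQ; exact: (mx_cvg_mul (mx_cvg_tr fQ) fQ).
have u1 := @corners_unit1 R n.
have cvgX : mx_cvg F (fun x => eliminator ((f x)^T *m f x)) 1%:M.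
  by rewrite -[in X in mx_cvg _ _ X]eliminator1; exact: mx_cvg_eliminator.
pose D x := eliminator ((f x)^T *m f x) *m ((f x)^T *m f x) *m
            (eliminator ((f x)^T *m f x))^T.
have cvgD : mx_cvg F D 1%:M.
  suff : mx_cvg F D (1%:M *m 1%:M *m 1%:M^T) by rewrite trmx1 !mulmx1.
  exact: (mx_cvg_mul (mx_cvg_mul cvgX cvgG) (mx_cvg_tr cvgX)).
have cvgDii i : D x i i @[x --> F] --> (1 : R).
  by have := cvgD i i; rewrite mxE eqxx.
have cvg_sqrt i : Num.sqrt (D x i i) @[x --> F] --> (1 : R).
  rewrite -(sqrtr1 R); apply: continuous_cvg; first exact: sqrt_continuous.
  exact: cvgDii.
split.
  rewrite -[Q]mulmx1; apply: mx_cvg_mul => //.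
  have -> : (1%:M : 'M[R]_n) = 1%:M^T *m 1%:M by rewrite trmx1 mulmx1.
  apply: mx_cvg_mul; first exact: mx_cvg_tr.
  move=> i j; rewrite mxE; under eq_cvg do rewrite mxE [X in X *+ _]mxE.
  case: (i == j); rewrite ?mulr1n ?mulr0n; last exact: cvg_cst.
  by rewrite -(invr1 R); apply: cvgV; [exact: oner_neq0|exact: cvg_sqrt].
have nD : \forall x \near F, forall i, 0 < D x i i.
  apply: filter_forall => i.
  exact: (cvgr_gt _ (cvgDii i) _ ltr01).
have nM : \forall x \near F, corners_unit ((f x)^T *m f x).
  exact: (near_corners_unit cvgG u1).
apply: filterS2 nM nD => x uM D0; split=> //.
exact: gram_schmidt_orthogonal.
Qed.

(** The zero entries of the subdiagonal coordinates of [T] are perturbed to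
    [eps], and [eps] tends to 0 through nonzero values. *)
Lemma unreduced_dense (R : realType) (n : nat) (lam : 'I_n -> R) (T : 'M[R]_n)
    (V : set 'M[R]_n) :
  injective lam -> isospectral lam T -> nbhs T V ->
  exists S : 'M[R]_n, [/\ isospectral lam S, unreduced S & V S].
Proof.
move=> injlam isoT TV; have [pi chartT] := chart_domain_cover injlam isoT.
have [_ [Q [[L [U [[trL dL] [trU dU] QE]]] orthQ TE]]] := chartT.
pose mu i := lam (pi i).
have injmu : injective mu by move=> i j /injlam/perm_inj.
have uL : L \in unitmx.
  by rewrite trig_unitmx //; apply/forallP => i; rewrite dL oner_eq0.
have uU : U \in unitmx.
  by rewrite -unitmx_tr trig_unitmx //; apply/forallP => i; rewrite mxE gt_eqF.
have trL' := trig_invmx trL uL.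
have trU' : is_trig_mx (invmx U)^T by rewrite trmx_inv trig_invmx ?unitmx_tr.
have trD : is_trig_mx (Lambda mu) by exact: diag_mx_is_trig.
have triT : hessenberg T.
  by move=> i j ji; have [_ triT _] := isoT; apply: triT; rewrite ji orbT.
pose Z := invmx L *m Lambda mu *m L.
have ZE : Z = U *m T *m invmx U.
  apply: (canRL (mulmxK uU)); rewrite /Z -[_ *m L *m U]mulmxA -QE -mulmxA.
  apply: (canLR (mulKmx uL)); rewrite mulmxA -QE TE.
  by rewrite !mulmxA (mulmx1C orthQ) mul1mx.
(* [L^-1 Lambda L] is lower triangular and [U T U^-1] is Hessenberg *)
have Zbidiag : Z = bidiag mu (subdiag Z).
  apply: lower_hessenberg_bidiag => [||i].
  - by rewrite !trig_mulmx.
  - by rewrite ZE; apply: hessenberg_mul_upper => //; exact: upper_mul_hessenberg.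
  rewrite !trig_mulmx_diag ?trig_mulmx // trig_invmx_diag // dL invr1.
  by rewrite mul1r mulr1 !mxE eqxx.
have LE : L = bidiag_eigen mu (subdiag Z).
  by apply: bidiag_eigen_unique => //; rewrite -Zbidiag !mulmxA mulmxV // mul1mx.
pose beta (eps : R) j := if subdiag Z j == 0 then eps else subdiag Z j.
have cvg_beta j : beta eps j @[eps --> 0^'] --> subdiag Z j.
  rewrite /beta; case: eqP => [->|_]; last exact: cvg_cst.
  by apply: cvg_within_filter; exact: cvg_id.
pose f eps := bidiag_eigen mu (beta eps) *m U.
have cvgf : mx_cvg 0^' f Q.
  rewrite QE LE; apply: mx_cvg_mul; last exact: mx_cvg_cst.
  move=> i j; rewrite mxE; under eq_cvg do rewrite mxE.
  case: ifP => _; first exact: cvg_cst.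
  by apply: prod_cvg => l _; apply: cvgM; [exact: cvg_beta|exact: cvg_cst].
have [cvgQ nearQ] := mx_cvg_gram_schmidt orthQ cvgf.
pose Qe eps := f eps *m gram_schmidt (f eps).
have cvgT : mx_cvg 0^' (fun eps => (Qe eps)^T *m Lambda mu *m Qe eps) T.
  rewrite TE; apply: mx_cvg_mul => //; apply: mx_cvg_mul; first exact: mx_cvg_tr.
  exact: mx_cvg_cst.
have nearV : \forall eps \near 0^', V ((Qe eps)^T *m Lambda mu *m Qe eps).
  exact: nbhs_mx_cvg cvgT TV.
have near0 : \forall eps \near (0 : R)^', eps != 0 by exact: nbhs_dnbhs_neq.
have [eps [[eps0 Veps] [uM orthQe]]] :=
  filter_ex (filterI (filterI near0 nearV) nearQ).
have QeE : Qe eps = bidiag_eigen mu (beta eps) *m (U *m gram_schmidt (f eps)).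
  by rewrite mulmxA.
have [|||i j ij|||isoS unrS] := @isospectral_of_LU _ _ lam pi
    (bidiag_eigen mu (beta eps)) (bidiag mu (beta eps)) (U *m gram_schmidt (f eps)).
- rewrite trig_unitmx ?bidiag_eigen_trig //.
  by apply/forallP => i; rewrite bidiag_eigen_diag oner_eq0.
- exact: bidiag_eigenP.
- exact: bidiag_hessenberg.
- have ji : (j < i)%N by rewrite ij.
  rewrite mxE -val_eqE (gtn_eqF ji) ij eqxx /beta.
  by case: (eqVneq (subdiag Z j) 0).
- by rewrite trmx_mul trig_mulmx // gram_schmidt_trig.
- by rewrite -QeE.
by exists ((Qe eps)^T *m Lambda mu *m Qe eps); split=> //; rewrite QeE.
Qed.

(** * Covering, density and block structure of the charts *)

Theorem lemma3p2 (R : realType) (n : nat) (lam : 'I_n -> R)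
    (lam_incr : forall i j : 'I_n, (i < j)%N -> lam i < lam j) :
  [/\ (* (a) *)
      open_fam_of (isospectral lam) [set: 'S_n] (chart_domain lam) /\
      isospectral lam = cover [set: 'S_n] (chart_domain lam),
      (* (b) *)
      forall (pi : 'S_n) (E T : 'M[R]_n), sign_diagonal E ->
        chart_domain lam pi T -> chart_domain lam pi (E *m T *m E),
      (* (c) *)
      (forall T : 'M[R]_n, isospectral lam T -> unreduced T ->
         forall pi : 'S_n, chart_domain lam pi T) /\
      (forall pi : 'S_n,
         dense [set T : isospectral lam | chart_domain lam pi (set_val T)])
    & (* (d) *)
      forall (T : 'M[R]_n) (k : nat) (p : 'I_k -> nat)
        (e : (\sum_(i < k) p i)%N = n) (B : forall i : 'I_k, 'M[R]_(p i)),
        isospectral lam T -> unreduced_blocks e B T ->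
        forall pi : 'S_n,
          chart_domain lam pi T <->
          (forall i : 'I_k, conjugate_mx (B i) (Lambda_perm_block e lam pi i))].
Proof.
have injlam : injective lam.
  move=> i j lamE; apply/val_inj/eqP; rewrite eqn_leq.
  by apply/andP; split; rewrite leqNgt; apply/negP => /lam_incr;
    rewrite lamE ltxx.
have unr_chart T : isospectral lam T -> unreduced T ->
    forall pi : 'S_n, chart_domain lam pi T.
  move=> isoT unrT pi; have [_ triT conjT] := isoT.
  have /conjugate_LambdaP[P uP PT] : conjugate_mx T (Lambda_perm lam pi).
    exact/conjugate_Lambda_perm.
  apply/(chart_domainP _ _ injlam); split=> //; exists P => //.
  apply: corners_has_LU; apply: unreduced_eigen_corners uP PT => //.
    by move=> i j /injlam/perm_inj.
  by move=> i j ji; apply: triT; rewrite ji orbT.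
split.
- split.
    exists (fun pi => [set T | exists W, corners_unit
                       (probe (fun i => lam (pi i)) W T)]) => pi _.
      exact: open_corners_probe.
    exact: chart_domain_probe.
  apply/seteqP; split=> [T isoT|T [pi _ []]//].
  by have [pi chartT] := chart_domain_cover injlam isoT; exists pi.
- by move=> pi E T; exact: chart_domain_sign.
- split=> // pi O [T OT] [V openV VO].
  have isoT : isospectral lam (set_val T) by exact: set_valP.
  have VT : nbhs (set_val T) V.
    by apply: open_nbhs_nbhs; split=> //; rewrite -VO in OT.
  have [S [isoS unrS VS]] := unreduced_dense injlam isoT VT.
  exists (SigSub (mem_set isoS)); split; last exact: unr_chart.
  by rewrite -VO.
by move=> T k p e B isoT unrB pi; exact: chart_domain_blocks.
Qed.
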